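(* Let $n\ge 2$ and let $A$ be an $n$-by-$n$ weighted shift matrix with complex weights $a_1,\ldots,a_n$. Then $A$ is reducible if and only if one of the following cases holds: (a) $a_i=a_j=0$ for some $1\le i<j\le n$; (b) $A$ has periodic weights.
   Context: An $n$-by-$n$ weighted shift matrix with weights $a_1,\ldots,a_n\in\mathbb{C}$ is the matrix whose $(j,j+1)$-entry is $a_j$ for $1\le j\le n-1$, whose $(n,1)$-entry is $a_n$, and whose other entries are all $0$. $A$ has periodic weights if for some fixed $k$, $1\le k\le\lfloor n/2\rfloor$, $n$ is divisible by $k$ and $|a_j|=|a_{k+j}|$ for all $1\le j\le n-k$. A square complex matrix is reducible if it is unitarily equivalent to the direct sum of two other (nonempty square) matrices. ''One of the cases holds'' means at least one holds. *)

(* Defs.v *)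
From HB Require Import structures.
From mathcomp Require Import all_boot all_order all_algebra spectral sesquilinear.
From mathcomp Require Import complex.
From mathcomp Require Import reals.

Set Implicit Arguments.
Unset Strict Implicit.
Unset Printing Implicit Defensive.

Import Order.TTheory GRing.Theory Num.Theory.
Local Open Scope ring_scope.
Local Open Scope sesquilinear_scope.

(* Rows, columns and weights are indexed from 0: the usual a_j is
   [a i] with i = j - 1. *)
Definition weighted_shift (C : numClosedFieldType) (n : nat) (a : 'I_n -> C) :
    'M[C]_n :=
  \matrix_(i, j)
    if (j == i.+1 :> nat) || ((i.+1 == n) && (j == 0%N :> nat))
    then a i else 0.

(* The last condition quantifies over the i for which i + k is still a valid
   index: no wrap-around modulo n. *)
Definition periodic_weights (C : numClosedFieldType) (n : nat)
    (a : 'I_n -> C) : Prop :=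
  exists k : nat,
    [/\ (1 <= k <= n./2)%N, (k %| n)%N
      & forall i j : 'I_n, j = (k + i)%N :> nat -> `|a i| = `|a j|].

Definition unitarily_equivalent (C : numClosedFieldType) (n : nat)
    (A B : 'M[C]_n) : Prop :=
  exists2 U : 'M[C]_n, U \is unitarymx & A = U^t* *m B *m U.

Definition reducible (C : numClosedFieldType) (n : nat) (A : 'M[C]_n) : Prop :=
  exists (p q : nat) (e : (p + q)%N = n) (B : 'M[C]_p) (D : 'M[C]_q),
    [/\ (0 < p)%N, (0 < q)%N
      & unitarily_equivalent A (castmx (e, e) (block_mx B 0 0 D))].

(* Main.v *)
Require Import Defs.
From mathcomp Require Import all_boot all_order all_algebra complex reals.
From mathcomp Require Import perm spectral sesquilinear.
From mathcomp Require Import zify ring.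

Set Implicit Arguments.
Unset Strict Implicit.
Unset Printing Implicit Defensive.

Import Order.TTheory GRing.Theory Num.Theory.
Local Open Scope ring_scope.
Local Open Scope sesquilinear_scope.

(** A matrix is reducible exactly when it commutes with a normal matrix that is
    not scalar: a decomposition gives the orthogonal projection onto one of the
    summands, and conversely, in an orthonormal eigenbasis of the normal matrix,
    every matrix commuting with it is block diagonal along the eigenspaces
    ([reducible_herm_commutant], [reducible_normal_commutant]).  The first
    direction yields a hermitian matrix, hence a relation with the adjoint; the
    second one lets the commuting matrix be unitary.

    Indices are read modulo n, so that a weighted shift A is e_i |-> a_i e_(i+1)
    on row vectors, and AP = PA means a_i P_(i+1,j+1) = a_j P_(i,j).

    Suppose that A is reducible and that at most one weight vanishes; let P be
    hermitian, not scalar, with AP = PA.  Combining the relation above with its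
    adjoint gives |a_i| = |a_j| whenever P_(i,j) <> 0.  If such an entry exists
    off the diagonal, both weights are nonzero, so the next entry P_(i+1,j+1) on
    the cyclic diagonal is nonzero too; following the whole diagonal,
    the moduli of the weights are invariant under translation by j - i, hence by
    its gcd with n ([herm_comm_periodic]).  Otherwise P is diagonal, and
    a_i P_(i+1,i+1) = a_i P_(i,i) links all the diagonal entries of P, since
    a cycle with at most one link removed is connected; then P is scalar, which
    is excluded ([comm_diag_scalar]).

    Conversely, a unitary matrix e_i |-> s_i e_(i+k) with |s_i| = 1 commutes with
    A as soon as a_i s_(i+1) = s_i a_(i+k).  When a_i = a_j = 0, take k = 0 and
    the sign s that changes exactly after i and after j
    ([reducible_two_zeros]).  When the moduli are k-periodic and no weight
    vanishes, solve s_(i+1) = s_i a_(i+k) / a_i around the cycle, the ratios having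
    product 1 ([reducible_cyclic_periodic]); if some weight vanishes, so
    does the one k further, and the previous case applies. *)

(** * Reducibility and the commutant *)

Section Commutant.
Variable C : numClosedFieldType.

Lemma trmxC_mul m n p (A : 'M[C]_(m, n)) (B : 'M[C]_(n, p)) :
  (A *m B)^t* = B^t* *m A^t*.
Proof. by rewrite trmx_mul map_mxM. Qed.

Lemma reducible_unitary n (A B U : 'M[C]_n) :
  U \is unitarymx -> A = U^t* *m B *m U -> reducible B -> reducible A.
Proof.
move=> Uu -> [p [q [e [B1 [B2 [p0 q0 [V Vu ->]]]]]]].
exists p, q, e, B1, B2; split=> //; exists (V *m U).
  exact: mul_unitarymx.
by rewrite trmxC_mul !mulmxA.
Qed.

(** The witness is the orthogonal projection onto the first summand.  It is
    hermitian, so that it commutes with the adjoint of [A] as well. *)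
Lemma reducible_herm_commutant n (A : 'M[C]_n) : reducible A ->
  exists P : 'M[C]_n, [/\ P^t* = P, A *m P = P *m A & ~~ is_scalar_mx P].
Proof.
case=> p [q [e [B [D [p0 q0 [U Uu ->]]]]]]; subst n; rewrite castmx_id.
set M := block_mx B 0 0 D.
pose E : 'M[C]_(p + q) := block_mx 1%:M 0 0 0.
have UU : U *m U^t* = 1%:M by apply/unitarymxP.
have ME : M *m E = E *m M.
  by rewrite !mulmx_block !(mulmx0, mul0mx, mulmx1, mul1mx, addr0).
exists (U^t* *m E *m U); split.
- rewrite !trmxC_mul trmxCK mulmxA; congr (_ *m _ *m _).
  by rewrite tr_block_mx map_block_mx !trmx0 !map_mx0 trmx1 map_mx1.
- rewrite !mulmxA -(mulmxA _ U) UU mulmx1 -(mulmxA _ U) UU mulmx1.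
  by rewrite -(mulmxA _ M) ME !mulmxA.
- apply/negP=> /is_scalar_mxP[c Ec].
  have {}Ec : E = c%:M.
    have := congr1 (fun X => U *m X *m U^t*) Ec.
    rewrite !mulmxA UU mul1mx -mulmxA UU mulmx1 => ->.
    by rewrite mul_mx_scalar -scalemxAl UU scalemx1.
  move/(congr1 (fun X : 'M_(p + q) => (ulsubmx X, drsubmx X))): Ec.
  rewrite scalar_mx_block !block_mxKul !block_mxKdr => -[E1 E0].
  have c0 : c = 0.
    have /matrixP/(_ (Ordinal q0) (Ordinal q0)) := E0.
    by rewrite !mxE eqxx.
  have /matrixP/(_ (Ordinal p0) (Ordinal p0)) := E1.
  by rewrite !mxE eqxx c0 => /eqP; rewrite oner_eq0.
Qed.

(** Turns a block structure indexed by an arbitrary set of indices into one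
    made of an initial and a final segment. *)
Lemma perm_to_front n (S : {set 'I_n}) :
  exists g : 'S_n, forall i, (g i \in S) = (i < #|S|)%N.
Proof.
case: n S => [|n] S; first by exists 1%g => -[].
pose s := enum S ++ enum (~: S).
have sz : size s = n.+1.
  by rewrite size_cat -!cardE cardsC card_ord.
have us : uniq s.
  rewrite cat_uniq !enum_uniq andbT /=; apply/hasPn=> x.
  by rewrite !mem_enum inE.
have g_inj : injective (fun i : 'I_n.+1 => nth ord0 s i).
  move=> i j /eqP; rewrite nth_uniq ?sz ?ltn_ord // => /eqP.
  exact: val_inj.
exists (perm g_inj) => i; rewrite permE nth_cat -cardE; case: ltnP => iS.
  by rewrite -mem_enum mem_nth // -cardE.
apply/negbTE; rewrite -in_setC -mem_enum mem_nth // -cardE.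
by rewrite ltn_subLR // cardsC card_ord.
Qed.

Lemma reducible_block n (B : 'M[C]_n) (S : {set 'I_n}) :
  S != set0 -> ~: S != set0 ->
  (forall i j, (i \in S) != (j \in S) -> B i j = 0) -> reducible B.
Proof.
rewrite -!card_gt0 => p0 q0 BS.
have [g gS] := perm_to_front S.
have e : (#|S| + #|~: S|)%N = n by rewrite cardsC card_ord.
move: (#|S|) (#|~: S|) e p0 q0 gS => p q e p0 q0 gS; subst n.
pose M : 'M[C]_(p + q) := \matrix_(i, j) B (g i) (g j).
have Mblock : M = block_mx (ulsubmx M) 0 0 (drsubmx M).
  rewrite -{1}[M]submxK; congr block_mx; apply/matrixP=> i j;
    by rewrite !mxE BS // !gS /= ltn_ord ltnNge leq_addr.
exists p, q, erefl, (ulsubmx M), (drsubmx M); split=> //.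
rewrite castmx_id -Mblock; exists (perm_mx g).
  by apply/unitarymxP; rewrite tr_perm_mx map_perm_mx -perm_mxM mulgV perm_mx1.
rewrite tr_perm_mx map_perm_mx -row_permE.
rewrite -[g in _ *m perm_mx g]invgK -col_permE.
by apply/matrixP=> i j; rewrite !mxE !permKV.
Qed.

(** In an orthonormal eigenbasis of [N], the entry (i, j) of a matrix commuting
    with [N] vanishes unless the eigenvalues at i and j agree; the indices
    sharing one given eigenvalue then split off. *)
Lemma reducible_normal_commutant n (A N : 'M[C]_n) :
  N \is normalmx -> A *m N = N *m A -> ~~ is_scalar_mx N -> reducible A.
Proof.
move=> /orthomx_spectralP; set W := spectralmx N; set d := spectral_diag N.
have Wu : W \is unitarymx by exact: spectral_unitarymx.
rewrite invmx_unitary // => ND AN Nns.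
have WW : W *m W^t* = 1%:M by apply/unitarymxP.
have WW' : W^t* *m W = 1%:M by apply: mulmx1C.
pose B := W *m A *m W^t*.
have AB : A = W^t* *m B *m W.
  by rewrite /B !mulmxA WW' mul1mx -mulmxA WW' mulmx1.
have DN : diag_mx d = W *m N *m W^t*.
  by rewrite ND !mulmxA WW mul1mx -mulmxA WW mulmx1.
have BD : B *m diag_mx d = diag_mx d *m B.
  rewrite DN /B !mulmxA -!(mulmxA _ (W^t*) W) WW' !mulmx1.
  by rewrite -(mulmxA W A) AN mulmxA.
apply: (reducible_unitary Wu AB).
have {BD}Bd i j : d 0 i != d 0 j -> B i j = 0.
  move=> dij; apply/eqP; have /matrixP/(_ i j) := BD.
  rewrite mul_mx_diag mul_diag_mx !mxE => /eqP.
  by rewrite mulrC -subr_eq0 -mulrBl mulf_eq0 subr_eq0 eq_sym (negbTE dij).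
have /existsP[i /existsP[j dij]] : [exists i, exists j, d 0 i != d 0 j].
  apply: contraNT Nns => /existsPn dc.
  apply/is_scalar_mxP; case: n A N W d Wu ND AN WW WW' B AB DN Bd dc.
    by move=> *; exists 0; apply/matrixP=> -[].
  move=> n A N W d Wu ND AN WW WW' B AB DN Bd dc; exists (d 0 0).
  have -> : N = W^t* *m (d 0 0)%:M *m W.
    rewrite {1}ND -diag_const_mx; congr (_ *m diag_mx _ *m _).
    apply/rowP=> j; rewrite mxE; have /existsPn/(_ 0) := dc j.
    by rewrite negbK => /eqP.
  by rewrite mul_mx_scalar -scalemxAl WW' scalemx1.
(* The index i only serves to select an eigenvalue; j shows that it is not the
   only one. *)
apply: (@reducible_block _ _ [set l | d 0 l == d 0 i]).
- by apply/set0Pn; exists i; rewrite inE.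
- by apply/set0Pn; exists j; rewrite !inE eq_sym.
- move=> k l; rewrite !inE => kl; apply: Bd; apply: contra kl => /eqP ->.
  exact: eqxx.
Qed.

(** * Weighted cyclic translations *)

(** On row vectors this is e_i |-> s_i e_(i+k), with indices modulo n+2.  Both the
    weighted shifts (k = 1) and the unitary matrices commuting with them
    are of this form; k = 0 gives the diagonal matrices. *)
Definition weighted_translation n (k : 'I_n.+2) (s : 'I_n.+2 -> C) :
    'M[C]_n.+2 :=
  \matrix_(i, j) if j == i + k then s i else 0.

Lemma val_Zp_succ n (i : 'I_n.+2) :
  (i + 1)%R = (if i == n.+1 :> nat then 0%N else i.+1) :> nat.
Proof.
rewrite /= (modn_small (erefl : (1 < n.+2)%N)) addn1.
have := ltn_ord i; rewrite ltnS leq_eqVlt; case: eqP => [-> _|_ /= ?].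
  by rewrite modnn.
by rewrite modn_small.
Qed.

Lemma weighted_shiftE n (a : 'I_n.+2 -> C) :
  weighted_shift a = weighted_translation 1 a.
Proof.
apply/matrixP=> i j; rewrite !mxE -[j == i + 1]val_eqE.
rewrite -[val (i + 1)]/(nat_of_ord (i + 1)) val_Zp_succ eqSS.
have := ltn_ord j; case: (i =P n.+1 :> nat) => [->|_] jn; last by rewrite orbF.
by rewrite (ltn_eqF jn).
Qed.

Section Translations.
Variables (n : nat).
Implicit Types (k l : 'I_n.+2) (s t a : 'I_n.+2 -> C) (M : 'M[C]_n.+2).

Lemma mul_weighted_translationE k s M i j :
  (weighted_translation k s *m M) i j = s i * M (i + k) j.
Proof.
rewrite !mxE (bigD1 (i + k)) //= mxE eqxx big1 ?addr0 // => l lik.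
by rewrite mxE (negbTE lik) mul0r.
Qed.

Lemma mulr_weighted_translationE k s M i j :
  (M *m weighted_translation k s) i (j + k) = M i j * s j.
Proof.
rewrite !mxE (bigD1 j) //= mxE eqxx big1 ?addr0 // => l lj.
by rewrite mxE (inj_eq (addIr k)) eq_sym (negbTE lj) mulr0.
Qed.

Lemma weighted_translation_comm k l s t :
  (forall i, s i * t (i + k) = t i * s (i + l)) ->
  weighted_translation k s *m weighted_translation l t =
  weighted_translation l t *m weighted_translation k s.
Proof.
move=> st; apply/matrixP=> i j; rewrite -(subrK k j).
rewrite mul_weighted_translationE mulr_weighted_translationE !mxE.
rewrite (addrAC i k l) (inj_eq (addIr k)).
by case: eqP => [->|_]; rewrite ?st ?mulr0 ?mul0r.
Qed.

Lemma weighted_translation_normal k s :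
  (forall i, `|s i| = 1) -> weighted_translation k s \is normalmx.
Proof.
move=> s1; set M := weighted_translation k s.
have MM : M *m M^t* = 1%:M.
  apply/matrixP=> i j; rewrite mul_weighted_translationE !mxE (inj_eq (addIr k)).
  by case: eqP => [->|_]; rewrite ?conjC0 ?mulr0 // -normCK s1 expr1n.
by apply/normalmxP; rewrite MM (mulmx1C MM).
Qed.

Lemma weighted_translation_nonscalar k s :
  (forall i, s i != 0) -> k != 0 \/ (exists i j, s i != s j) ->
  ~~ is_scalar_mx (weighted_translation k s).
Proof.
move=> s0 ks; apply/negP=> /is_scalar_mxP[c /matrixP E].
have sE x : s x = c *+ (k == 0).
  have := E x (x + k); rewrite !mxE eqxx.
  by rewrite -{2}[x]addr0 (inj_eq (addrI x)) eq_sym.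
case: ks => [k0|[i [j]]]; last by rewrite !sE eqxx.
by have := s0 0; rewrite sE (negbTE k0) eqxx.
Qed.

Lemma reducible_unimodular_symmetry k a s :
  (forall i, `|s i| = 1) -> (forall i, a i * s (i + 1) = s i * a (i + k)) ->
  k != 0 \/ (exists i j, s i != s j) -> reducible (weighted_shift a).
Proof.
move=> s1 sa ks; rewrite weighted_shiftE.
apply: (reducible_normal_commutant (weighted_translation_normal k s1)).
  exact: weighted_translation_comm.
by apply: weighted_translation_nonscalar => // i; rewrite -normr_eq0 s1 oner_eq0.
Qed.

(** The arcs from i+1 to j and from j+1 to i (cyclically) span two
    summands, since the shift moves nothing from one arc to the other.  The
    diagonal matrix with sign -1 on the first arc and 1 on the second records
    this. *)
Lemma reducible_two_zeros a (i j : 'I_n.+2) :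
  (i < j)%N -> a i = 0 -> a j = 0 -> reducible (weighted_shift a).
Proof.
move=> ij ai aj; pose s (l : 'I_n.+2) : C := (-1) ^+ (i < l <= j)%N.
apply: (@reducible_unimodular_symmetry 0 a s).
- by move=> l; rewrite normr_sign.
- move=> l; rewrite addr0 mulrC.
  have [->|/eqP li] := eqVneq l i; first by rewrite ai !mulr0.
  have [->|/eqP lj] := eqVneq l j; first by rewrite aj !mulr0.
  congr (_ * _); rewrite /s val_Zp_succ; congr (_ ^+ nat_of_bool _).
  have {}li : nat_of_ord l <> i by move/val_inj.
  have {}lj : nat_of_ord l <> j by move/val_inj.
  have := ltn_ord j; case: eqP; lia.
- right; exists i, j; rewrite /s ltnn ij leqnn /= expr0 expr1.
  by rewrite -subr_eq0 opprK -mulr2n pnatr_eq0.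
Qed.

(** Partial products solve the recurrence; [\prod_i c i = 1] is what closes
    the solution up around the cycle. *)
Lemma cyclic_cocycle (c : 'I_n.+2 -> C) :
  \prod_i c i = 1 -> (forall i, `|c i| = 1) ->
  exists s : 'I_n.+2 -> C,
    (forall i, `|s i| = 1) /\ (forall i, s (i + 1) = s i * c i).
Proof.
move=> c1 nc; exists (fun i => \prod_(l < n.+2 | (l < i)%N) c l); split=> i.
  by rewrite normr_prod big1.
rewrite (mulrC _ (c i)); transitivity (\prod_(l < n.+2 | (l <= i)%N) c l).
  rewrite val_Zp_succ; case: eqP => [iE|_]; last by apply: eq_bigl.
  rewrite big_pred0 // -[LHS]c1; apply: eq_bigl => l.
  by rewrite iE -ltnS ltn_ord.
rewrite (bigD1 i) //=; congr (_ * _); apply: eq_bigl => l.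
by rewrite andbC -val_eqE ltn_neqAle.
Qed.

(** The symmetry is translation by k, corrected by phases that
    turn the weights a_i into a_(i+k); such phases exist when no weight
    vanishes. *)
Lemma reducible_cyclic_periodic a k :
  k != 0 -> (forall i, `|a (i + k)| = `|a i|) -> reducible (weighted_shift a).
Proof.
move=> k0 ak.
have [/existsP[i /eqP ai]|/existsPn a0] := boolP [exists i, a i == 0].
  have aik : a (i + k) = 0 by apply/eqP; rewrite -normr_eq0 ak ai normr0.
  have [lt|gt|/val_inj eq] := ltngtP i (i + k)%R.
  - exact: reducible_two_zeros lt ai aik.
  - exact: reducible_two_zeros gt aik ai.
  - by move: k0; rewrite -(inj_eq (addrI i)) addr0 -eq eqxx.
have [||s [s1 sS]] := @cyclic_cocycle (fun i => a (i + k) / a i).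
- rewrite big_split /= prodfV (reindex_inj (addIr (- k))) /=.
  under eq_bigr do rewrite subrK.
  by rewrite divff //; apply/prodf_neq0 => i _; exact: a0.
- by move=> i; rewrite normrM normfV ak divff // normr_eq0 a0.
apply: (@reducible_unimodular_symmetry k a s s1); last by left.
by move=> i; rewrite sS mulrCA (mulrC (a i)) divfK.
Qed.

(** * Cyclic and non-cyclic periods *)

(** As k divides the order, the residue modulo k of an index is not affected by
    wrapping around; the moduli depend on this residue only. *)
Lemma periodic_weights_cyclic a : periodic_weights a ->
  exists2 k : 'I_n.+2, k != 0 & forall i, `|a (i + k)| = `|a i|.
Proof.
case=> k [/andP[k1 kn] kdvd ak].
have kn2 : (k < n.+2)%N by lia.
have apow q (i j : 'I_n.+2) : i = (q * k + j)%N :> nat -> `|a i| = `|a j|.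
  elim: q i => [|q IH] i iE; first by congr `|a _|; apply: val_inj.
  have lt : (q * k + j < n.+2)%N by have := ltn_ord i; rewrite iE mulSn; lia.
  by rewrite -(IH (Ordinal lt)) //; apply/esym/ak; rewrite iE mulSn /= addnA.
have amod (i j : 'I_n.+2) : (i %% k = j %% k)%N -> `|a i| = `|a j|.
  move=> ij; have lt : (i %% k < n.+2)%N by apply: leq_ltn_trans (leq_mod _ _) _.
  rewrite (apow (i %/ k)%N i (Ordinal lt)) ?(apow (j %/ k)%N j (Ordinal lt)) //=.
    by rewrite ij -divn_eq.
  by rewrite -divn_eq.
exists (Ordinal kn2); first by rewrite -val_eqE /= -lt0n.
by move=> i; apply: amod; rewrite /= modn_dvdm // modnDr.
Qed.

(** By Bezout, the periods modulo n are generated by a divisor of n, which is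
    at most n/2 because it is smaller than n. *)
Lemma cyclic_periodic_weights a k :
  k != 0 -> (forall i, `|a (i + k)| = `|a i|) -> periodic_weights a.
Proof.
move=> k0 ak; have k_gt0 : (0 < k)%N by rewrite lt0n.
have amul u i : `|a (i + k *+ u)| = `|a i|.
  by elim: u => [|u IH]; rewrite ?addr0 // mulrSr addrA ak.
have g0 : (0 < gcdn k n.+2)%N by rewrite gcdn_gt0 k_gt0.
exists (gcdn k n.+2); split.
- rewrite g0 /=; have /dvdnP[q qE] := dvdn_gcdr k n.+2.
  have := leq_ltn_trans (dvdn_leq k_gt0 (dvdn_gcdl k n.+2)) (ltn_ord k).
  by rewrite -leq_double -[X in (_ <= X)%N]addn0; case: q qE => [|[|q]]; lia.
- exact: dvdn_gcdr.
- have [u v uv _] := egcdnP n.+2 k_gt0; move=> i j ijE.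
  rewrite -(amul u i); congr `|a _|; apply: val_inj.
  rewrite Zp_mulrn /= modnDmr (mulnC k) uv addnCA modnMDl.
  by rewrite modn_small ?(addnC i) -?ijE.
Qed.

(** * The support of a commuting Hermitian matrix *)

(** A cycle remains connected after the removal of the edge from [z] to
    [z + 1]; the induction follows the remaining path from [z + 1]. *)
Lemma cyclic_constant (f : 'I_n.+2 -> C) (z : 'I_n.+2) :
  (forall i, i != z -> f (i + 1) = f i) -> forall i, f i = f (z + 1).
Proof.
move=> fz; have step (m : nat) : (m < n.+2)%N -> f (z + 1 + m%:R) = f (z + 1).
  elim: m => [|m IH] lt; first by rewrite addr0.
  rewrite -IH 1?ltnW // -natr1 addrA fz // -addrA nat1r.
  rewrite -[X in _ != X]addr0 (inj_eq (addrI z)).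
  by rewrite -val_eqE /= Zp_nat /= modn_small.
by move=> i; rewrite -(step (i - (z + 1))) ?ltn_ord // natr_Zp addrC subrK.
Qed.

Section HermitianCommutant.
Variables (a : 'I_n.+2 -> C) (P : 'M[C]_n.+2).
Hypothesis P_herm : P^t* = P.
Hypothesis aP : weighted_shift a *m P = P *m weighted_shift a.

Lemma comm_shiftE i j : a i * P (i + 1) (j + 1) = P i j * a j.
Proof.
rewrite -(mulr_weighted_translationE 1) -(mul_weighted_translationE 1).
by rewrite -weighted_shiftE aP.
Qed.

(** Commutation with the shift and with its adjoint both express
    P_(i+1,j+1) in terms of P_(i,j); the product of P_(i+1,j+1) by a_i and the
    conjugate of a_j is thus |a_j|^2 P_(i,j) by the former and |a_i|^2 P_(i,j)
    by the latter. *)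
Lemma herm_comm_norm_eq i j : P i j != 0 -> `|a i| = `|a j|.
Proof.
move=> Pij; have Pc k l : (P k l)^* = P l k by rewrite -{2}P_herm !mxE.
have E1 := comm_shiftE i j.
have E2 : (a j)^* * P (i + 1) (j + 1) = P i j * (a i)^*.
  by rewrite -(Pc (j + 1)) -(Pc j i) -!rmorphM comm_shiftE.
apply/eqP; rewrite -(eqrXn2 (n := 2)) // !normCK -subr_eq0.
suff /eqP : P i j * (a i * (a i)^* - a j * (a j)^*) = 0.
  by rewrite mulf_eq0 (negbTE Pij).
rewrite mulrBr (mulrC (a i)) mulrA -E2 (mulrA _ (a j)) -E1; ring.
Qed.

(** A nonzero entry propagates along its whole cyclic diagonal: two distinct
    weights of equal modulus cannot both vanish, so the commutation relation
    can be divided by them at each step. *)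
Lemma herm_comm_periodic i j :
  (forall k l, a k = 0 -> a l = 0 -> k = l) ->
  i != j -> P i j != 0 -> periodic_weights a.
Proof.
move=> a0 ij Pij.
have Pt (t : nat) : P (i + t%:R) (j + t%:R) != 0.
  elim: t => [|t IH]; first by rewrite !addr0.
  have aj0 : a (j + t%:R) != 0.
    apply: contra ij => /eqP aj; rewrite -(inj_eq (addIr t%:R)); apply/eqP/a0 => //.
    by apply/eqP; rewrite -normr_eq0 (herm_comm_norm_eq IH) aj normr0.
  rewrite -natr1 !addrA; apply/eqP=> P0.
  have /eqP := comm_shiftE (i + t%:R) (j + t%:R).
  by rewrite P0 mulr0 eq_sym mulf_eq0 (negbTE IH) (negbTE aj0).
apply: (@cyclic_periodic_weights a (j - i)); first by rewrite subr_eq0 eq_sym.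
move=> l; have := herm_comm_norm_eq (Pt (l - i)); rewrite natr_Zp.
by rewrite [i + _]addrC subrK => ->; congr `|a _|; ring.
Qed.

(** Each nonzero weight a_i forces the diagonal entries i and i+1 to agree. *)
Lemma comm_diag_scalar :
  (forall k l, a k = 0 -> a l = 0 -> k = l) ->
  (forall i j, i != j -> P i j = 0) -> is_scalar_mx P.
Proof.
move=> a0 Pd.
have [z az] : exists z, forall l, l != z -> a l != 0.
  have [/existsP[z /eqP az]|/existsPn na] := boolP [exists z, a z == 0].
    by exists z => l; apply: contra => /eqP al; apply/eqP/a0.
  by exists 0 => l _; exact: na.
have Pc : forall i, P i i = P (z + 1) (z + 1).
  apply: (@cyclic_constant (fun i => P i i)) => i iz.
  by apply: (mulfI (az i iz)); rewrite comm_shiftE mulrC.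
apply/is_scalar_mxP; exists (P (z + 1) (z + 1)); apply/matrixP=> i j.
by rewrite mxE; have [<-|/Pd ->] := eqVneq i j; first rewrite Pc.
Qed.

End HermitianCommutant.

Lemma reducible_zeros_or_periodic a : reducible (weighted_shift a) ->
  (exists i j : 'I_n.+2, [/\ (i < j)%N, a i = 0 & a j = 0]) \/
  periodic_weights a.
Proof.
move=> /reducible_herm_commutant[P [P_herm aP Pns]].
have [/existsP[i /existsP[j /and3P[ij /eqP ai /eqP aj]]]|no2] :=
  boolP [exists i : 'I_n.+2, exists j : 'I_n.+2, [&& (i < j)%N, a i == 0 & a j == 0]].
  by left; exists i, j.
right.
have a0 k l : a k = 0 -> a l = 0 -> k = l.
  have lt0 (x y : 'I_n.+2) : (x < y)%N -> a x = 0 -> a y = 0 -> False.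
    move=> xy ax ay; case/negP: no2; apply/existsP; exists x.
    by apply/existsP; exists y; rewrite xy ax ay eqxx.
  move=> ak al; case: (ltngtP k l) => [kl|lk|/val_inj //].
    by case: (lt0 k l).
  by case: (lt0 l k).
have [/existsP[i /existsP[j /andP[ij Pij]]]|Pd] :=
  boolP [exists i, exists j, (i != j) && (P i j != 0)].
  exact: herm_comm_periodic Pij.
case/negP: Pns; apply: (comm_diag_scalar aP a0) => i j ij; apply/eqP.
apply: contraNT Pd => Pij; apply/existsP; exists i.
by apply/existsP; exists j; rewrite ij.
Qed.

End Translations.
End Commutant.

Local Open Scope complex_scope.

Theorem corollary3p3 (R : realType) (n : nat) (a : 'I_n -> R[i]) (hn : (2 <= n)%N) :
  reducible (weighted_shift a) <->
  (exists i j : 'I_n, [/\ (i < j)%N, a i = 0 & a j = 0]) \/ periodic_weights a.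
Proof.
case: n a hn => [|[|n]] // a _; split; first exact: reducible_zeros_or_periodic.
case=> [[i [j [ij ai aj]]]|/periodic_weights_cyclic[k k0 ak]].
  exact: reducible_two_zeros ij ai aj.
exact: reducible_cyclic_periodic k0 ak.
Qed.
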